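(* Let $S,S^\perp$ be a pair of non-degenerate conjugate conics in $\mathbb R^{2,2}$. Then they are of one of the following types. **Case 1 (line-empty pairs).** $S$ is a line and $S^\perp$ is at infinity, i.e. $S^\perp=\emptyset$ (or vice versa). **Case 2.** $S$ and $S^\perp$ are contained in complementary affine $2$-planes $\pi$ and $\pi^\perp$ of $\mathbb R^{2,2}$, respectively, and one of the following holds: (i) (circles in definite planes) $S=\pi\cap H_{\underline p,\pm r^2}$ and $S^\perp=\pi^\perp\cap H_{\underline p,\mp r^2}$, where $\pi,\pi^\perp$ are definite affine planes in $\mathbb R^{2,2}$ intersecting at $\underline p\in\mathbb R^{2,2}$, and $r^2\neq 0$; (ii) (hyperbolae in indefinite planes) $S=\pi\cap H_{\underline p,\pm r^2}$ and $S^\perp=\pi^\perp\cap H_{\underline p,\mp r^2}$, where $\pi,\pi^\perp$ are indefinite affine planes in $\mathbb R^{2,2}$ intersecting at $\underline p\in\mathbb R^{2,2}$, and $r^2\neq 0$; (iii) (parabolae in degenerate planes) $S=\pi\cap C_{\underline{\tilde p}}$ and $S^\perp=\pi^\perp\cap C_{\underline p}$, where $\pi,\pi^\perp$ are non-intersecting degenerate affine planes in $\mathbb R^{2,2}$ and $\underline p\in\pi$, $\underline{\tilde p}\in\pi^\perp$ are null-separated points. In (i) and (ii) the signs are read consistently: either both upper signs or both lower signs are taken.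
   Context: $\mathbb R^{2,2}$ is $\mathbb R^4$ with the bilinear form $\langle\underline x,\underline x'\rangle=x_1x_1'+x_2x_2'-x_3x_3'-x_4x_4'$, quadratic form $\|\underline x\|^2=\langle\underline x,\underline x\rangle$, i.e. the flat metric $g=dx_1^2+dx_2^2-dx_3^2-dx_4^2$. Points $\underline x,\underline y$ are null-separated if $\|\underline x-\underline y\|^2=0$. $H_{\underline a,\pm r^2}=\{\underline x:\|\underline x-\underline a\|^2=\pm r^2\}$ is the hypersphere with center $\underline a$ and radius-square $\pm r^2$; $C_{\underline a}=\{\underline x:\|\underline x-\underline a\|^2=0\}$. An affine $2$-plane is definite, indefinite or degenerate according to whether the form induced on it by $g$ is definite, (nondegenerate) indefinite, or degenerate. Two affine $2$-planes are complementary if their direction planes are orthogonal complements of each other with respect to $\langle\cdot,\cdot\rangle$. $\mathbb R^{3,3}$ is $\mathbb R^6$, with vectors written $\mathbf s=(s_0,\underline s,s_5)$, $\underline s\in\mathbb R^{2,2}$, and bilinear form $(\mathbf s,\mathbf s')=s_0s_0'+\langle\underline s,\underline s'\rangle-s_5s_5'$. For $\underline x\in\mathbb R^{2,2}$ put $\mathbf s_{\underline x}=\left(\tfrac{1-\|\underline x\|^2}{2},\underline x,\tfrac{1+\|\underline x\|^2}{2}\right)$, a null vector of $\mathbb R^{3,3}$. Let $J$ be the Gram matrix of $(\cdot,\cdot)$ and $O^\pm(3,3)=\{\Lambda\in GL(6):\Lambda^TJ\Lambda=\pm J\}$. A conformal map $f$ of $\mathbb R^{2,2}$ is the (possibly only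 partially defined) transformation induced by some $\Lambda\in O^\pm(3,3)$: $f(\underline x)$ is the point such that $\mathbf s_{f(\underline x)}$ is a nonzero multiple of $\Lambda\mathbf s_{\underline x}$; the points $\underline x$ for which $\Lambda\mathbf s_{\underline x}$ satisfies $s_0+s_5=0$ are sent to infinity. The image of a set under $f$ consists of the points $f(\underline x)$ for $\underline x$ in the set not sent to infinity (so it may be empty). Let $S_0=\{(\alpha_1,\alpha_2,0,0):\alpha_1^2+\alpha_2^2=1\}$ and $S_0^\perp=\{(0,0,\beta_1,\beta_2):\beta_1^2+\beta_2^2=1\}$. A pair of non-degenerate conjugate conics $S,S^\perp$ is the image of $S_0,S_0^\perp$ under a conformal map of $\mathbb R^{2,2}$. *)

(* Defs.v *)
From HB Require Import structures.
From mathcomp Require Import all_boot all_order all_algebra.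
From mathcomp Require Import boolp classical_sets reals.

Set Implicit Arguments.
Unset Strict Implicit.
Unset Printing Implicit Defensive.

Import Order.TTheory GRing.Theory Num.Theory.

Local Open Scope classical_set_scope.
Local Open Scope ring_scope.

(* Coordinates are numbered from 0: the x_1, x_2, x_3, x_4 of R^{2,2} are
   x 0 0, x 1 0, x 2 0, x 3 0. *)
Definition form22 (R : realType) (x y : 'cV[R]_4) : R :=
  x 0 0 * y 0 0 + x 1 0 * y 1 0 - x 2 0 * y 2 0 - x 3 0 * y 3 0.

Definition norm22 (R : realType) (x : 'cV[R]_4) : R := form22 x x.

Definition null_separated (R : realType) (x y : 'cV[R]_4) : Prop :=
  norm22 (x - y) = 0.

(* The radius-square c is any real number, possibly negative. *)
Definition hypersphere (R : realType) (a : 'cV[R]_4) (c : R) :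
    set 'cV[R]_4 :=
  [set x | norm22 (x - a) = c].

Definition null_cone (R : realType) (a : 'cV[R]_4) : set 'cV[R]_4 :=
  [set x | norm22 (x - a) = 0].

Definition is_line (R : realType) (S : set 'cV[R]_4) : Prop :=
  exists a v : 'cV[R]_4,
    v != 0 /\ S = [set x | exists t : R, x = a + t *: v].

(* An affine 2-plane is presented by a base point and its direction; the base
   point is not unique, so planes are compared through [plane_set]. *)
Record plane (R : realType) := Plane {
  plane_base : 'cV[R]_4;
  plane_dir : {vspace 'cV[R]_4};
  plane_dim : (\dim plane_dir = 2)%N
}.

Definition plane_set (R : realType) (P : plane R) : set 'cV[R]_4 :=
  [set x | x - plane_base P \in plane_dir P].

Definition definite_plane (R : realType) (P : plane R) : Prop :=
  (forall u, u \in plane_dir P -> u != 0 -> 0 < norm22 u) \/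
  (forall u, u \in plane_dir P -> u != 0 -> norm22 u < 0).

Definition degenerate_plane (R : realType) (P : plane R) : Prop :=
  exists u, [/\ u \in plane_dir P, u != 0 &
    forall v, v \in plane_dir P -> form22 u v = 0].

Definition indefinite_plane (R : realType) (P : plane R) : Prop :=
  [/\ ~ degenerate_plane P,
      exists u, u \in plane_dir P /\ 0 < norm22 u &
      exists u, u \in plane_dir P /\ norm22 u < 0].

Definition orthogonal_complement (R : realType) (D E : {vspace 'cV[R]_4}) :
    Prop :=
  forall v, v \in E <-> (forall u, u \in D -> form22 u v = 0).

Definition complementary (R : realType) (P Q : plane R) : Prop :=
  orthogonal_complement (plane_dir P) (plane_dir Q) /\
  orthogonal_complement (plane_dir Q) (plane_dir P).

(* R^{3,3}: a vector s = (s_0, \underline s, s_5) is stored in blocks of sizes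
   1, 4, 1. *)
Definition vec33 (R : realType) (a : R) (x : 'cV[R]_4) (b : R) :
    'cV[R]_(1 + (4 + 1)) :=
  col_mx a%:M (col_mx x b%:M).

Definition fst33 (R : realType) (s : 'cV[R]_(1 + (4 + 1))) : R :=
  usubmx s 0 0.

Definition mid33 (R : realType) (s : 'cV[R]_(1 + (4 + 1))) : 'cV[R]_4 :=
  usubmx (dsubmx s).

Definition last33 (R : realType) (s : 'cV[R]_(1 + (4 + 1))) : R :=
  dsubmx (dsubmx s) 0 0.

Definition form33 (R : realType) (s t : 'cV[R]_(1 + (4 + 1))) : R :=
  fst33 s * fst33 t + form22 (mid33 s) (mid33 t) - last33 s * last33 t.

Definition gram33 (R : realType) : 'M[R]_(1 + (4 + 1)) :=
  \matrix_(i, j) form33 (delta_mx i 0) (delta_mx j 0).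

Definition Opm33 (R : realType) (L : 'M[R]_(1 + (4 + 1))) : Prop :=
  L \in unitmx /\
  (L^T *m gram33 R *m L = gram33 R \/ L^T *m gram33 R *m L = - gram33 R).

Definition lift33 (R : realType) (x : 'cV[R]_4) : 'cV[R]_(1 + (4 + 1)) :=
  vec33 ((1 - norm22 x) / 2) x ((1 + norm22 x) / 2).

Definition sent_to_infinity (R : realType) (L : 'M[R]_(1 + (4 + 1)))
    (x : 'cV[R]_4) : Prop :=
  fst33 (L *m lift33 x) + last33 (L *m lift33 x) = 0.

(* The graph of the partial map f induced by L: [conformal_graph L x y] says
   that f(x) = y. *)
Definition conformal_graph (R : realType) (L : 'M[R]_(1 + (4 + 1)))
    (x y : 'cV[R]_4) : Prop :=
  exists c : R, c != 0 /\ lift33 y = c *: (L *m lift33 x).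

Definition conformal_image (R : realType) (L : 'M[R]_(1 + (4 + 1)))
    (A : set 'cV[R]_4) : set 'cV[R]_4 :=
  [set y | exists x, [/\ A x, ~ sent_to_infinity L x & conformal_graph L x y]].

Definition circle0 (R : realType) : set 'cV[R]_4 :=
  [set x | [/\ x 0 0 ^+ 2 + x 1 0 ^+ 2 = 1, x 2 0 = 0 & x 3 0 = 0]].

Definition circle0_perp (R : realType) : set 'cV[R]_4 :=
  [set x | [/\ x 0 0 = 0, x 1 0 = 0 & x 2 0 ^+ 2 + x 3 0 ^+ 2 = 1]].

Definition conjugate_conics (R : realType) (S S' : set 'cV[R]_4) : Prop :=
  exists L : 'M[R]_(1 + (4 + 1)),
    [/\ Opm33 L, S = conformal_image L (@circle0 R) &
        S' = conformal_image L (@circle0_perp R)].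

(* The planes meet exactly at p and cut out the two conics from the
   hyperspheres about p of opposite radius-squares, with either both upper or
   both lower signs. *)
Definition concentric_sections (R : realType) (S S' : set 'cV[R]_4)
    (P P' : plane R) : Prop :=
  exists (p : 'cV[R]_4) (r : R),
    [/\ plane_set P `&` plane_set P' = [set p],
        r ^+ 2 != 0 &
        (S = plane_set P `&` hypersphere p (r ^+ 2) /\
         S' = plane_set P' `&` hypersphere p (- (r ^+ 2))) \/
        (S = plane_set P `&` hypersphere p (- (r ^+ 2)) /\
         S' = plane_set P' `&` hypersphere p (r ^+ 2))].

Definition parabolic_sections (R : realType) (S S' : set 'cV[R]_4)
    (P P' : plane R) : Prop :=
  plane_set P `&` plane_set P' = set0 /\
  exists p p' : 'cV[R]_4,
    [/\ plane_set P p, plane_set P' p', null_separated p p',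
        S = plane_set P `&` null_cone p' &
        S' = plane_set P' `&` null_cone p].

(* Main.v *)
Require Import Defs.
From HB Require Import structures.
From mathcomp Require Import all_boot all_order all_algebra.
From mathcomp Require Import boolp classical_sets reals.
From mathcomp Require Import ring lra.

Set Implicit Arguments.
Unset Strict Implicit.
Unset Printing Implicit Defensive.

Import Order.TTheory GRing.Theory Num.Theory.

Local Open Scope classical_set_scope.
Local Open Scope ring_scope.

(* The point at infinity is the null vector n = (1, 0, -1) of R^{3,3}: lifts are
   the null vectors s with (s, n) = 1, and x |-> s_x is, up to the factor -1/2,
   an isometry from |x - y|^2 to (s_x, s_y).  The conics S0 and S0^perp are the
   sets of points whose lifts lie in W = span(e1, e2, e5) and in W^perp, so S and
   S^perp are those whose lifts lie in U = Lambda W and in U^perp.  Write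
   n = n1 + n2 with n1 in U and n2 in U^perp.  If n1 or n2 vanishes, one conic is
   empty and the other is a line.  Otherwise the vectors of U orthogonal to n
   project isometrically onto the direction plane of S, and those of U^perp onto
   that of S^perp.  If k = (n1, n1) <> 0, the planes meet at the point p with
   s_p = (n1 - n2) / (2k), and the radius-squares are -1/k and 1/k.  If k = 0,
   the planes are degenerate and disjoint, and p, p' are lifted to null vectors
   of U and U^perp. *)

(** * Bilinearity of the two forms *)

Lemma form22C (R : realType) (x y : 'cV[R]_4) : form22 x y = form22 y x.
Proof. by rewrite /form22; ring. Qed.

Lemma form22Dl (R : realType) (x y z : 'cV[R]_4) :
  form22 (x + y) z = form22 x z + form22 y z.
Proof. by rewrite /form22 !mxE; ring. Qed.

Lemma form22Zl (R : realType) (c : R) (x y : 'cV[R]_4) :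
  form22 (c *: x) y = c * form22 x y.
Proof. by rewrite /form22 !mxE; ring. Qed.

Lemma form22Dr (R : realType) (x y z : 'cV[R]_4) :
  form22 x (y + z) = form22 x y + form22 x z.
Proof. by rewrite /form22 !mxE; ring. Qed.

Lemma form22Zr (R : realType) (c : R) (x y : 'cV[R]_4) :
  form22 x (c *: y) = c * form22 x y.
Proof. by rewrite /form22 !mxE; ring. Qed.

Lemma form33C (R : realType) (s t : 'cV[R]_(1 + (4 + 1))) :
  form33 s t = form33 t s.
Proof. by rewrite /form33 form22C; ring. Qed.

Lemma mid33D (R : realType) (s t : 'cV[R]_(1 + (4 + 1))) :
  mid33 (s + t) = mid33 s + mid33 t.
Proof. by apply/colP => i; rewrite !mxE. Qed.

Lemma mid33Z (R : realType) (c : R) (s : 'cV[R]_(1 + (4 + 1))) :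
  mid33 (c *: s) = c *: mid33 s.
Proof. by apply/colP => i; rewrite !mxE. Qed.

Lemma mid33N (R : realType) (s : 'cV[R]_(1 + (4 + 1))) :
  mid33 (- s) = - mid33 s.
Proof. by apply/colP => i; rewrite !mxE. Qed.

Lemma form33Dl (R : realType) (s t w : 'cV[R]_(1 + (4 + 1))) :
  form33 (s + t) w = form33 s w + form33 t w.
Proof. by rewrite /form33 mid33D form22Dl /fst33 /last33 !mxE; ring. Qed.

Lemma form33Zl (R : realType) (c : R) (s t : 'cV[R]_(1 + (4 + 1))) :
  form33 (c *: s) t = c * form33 s t.
Proof. by rewrite /form33 mid33Z form22Zl /fst33 /last33 !mxE; ring. Qed.

Lemma form33Nl (R : realType) (s t : 'cV[R]_(1 + (4 + 1))) :
  form33 (- s) t = - form33 s t.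
Proof. by rewrite -scaleN1r form33Zl mulN1r. Qed.

Lemma form33Dr (R : realType) (s t w : 'cV[R]_(1 + (4 + 1))) :
  form33 w (s + t) = form33 w s + form33 w t.
Proof. by rewrite !(form33C w) form33Dl. Qed.

Lemma form33Zr (R : realType) (c : R) (s t : 'cV[R]_(1 + (4 + 1))) :
  form33 s (c *: t) = c * form33 s t.
Proof. by rewrite !(form33C s) form33Zl. Qed.

Lemma form33Nr (R : realType) (s t : 'cV[R]_(1 + (4 + 1))) :
  form33 s (- t) = - form33 s t.
Proof. by rewrite !(form33C s) form33Nl. Qed.

Definition form33E :=
  (form33Dl, form33Dr, form33Nl, form33Nr, form33Zl, form33Zr).

(** * Points of R^{2,2} as null vectors of R^{3,3} *)

Lemma fst33_vec (R : realType) (a b : R) x : fst33 (vec33 a x b) = a.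
Proof. by rewrite /fst33 col_mxKu mxE. Qed.

Lemma mid33_vec (R : realType) (a b : R) x : mid33 (vec33 a x b) = x.
Proof. by rewrite /mid33 col_mxKd col_mxKu. Qed.

Lemma last33_vec (R : realType) (a b : R) x : last33 (vec33 a x b) = b.
Proof. by rewrite /last33 !col_mxKd mxE. Qed.

Definition vec33E := (fst33_vec, mid33_vec, last33_vec).

Lemma form33_vec (R : realType) (a b a' b' : R) x x' :
  form33 (vec33 a x b) (vec33 a' x' b') = a * a' + form22 x x' - b * b'.
Proof. by rewrite /form33 !vec33E. Qed.

Lemma vec33_eta (R : realType) (s : 'cV[R]_(1 + (4 + 1))) :
  s = vec33 (fst33 s) (mid33 s) (last33 s).
Proof.
by rewrite /vec33 /fst33 /mid33 /last33 -!mx11_scalar !vsubmxK.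
Qed.

(* The null vector dual to the hyperplane [s_0 + s_5 = 0]. *)
Definition infty33 (R : realType) : 'cV[R]_(1 + (4 + 1)) := vec33 1 0 (-1).

Lemma form33_infty (R : realType) (s : 'cV[R]_(1 + (4 + 1))) :
  form33 s (infty33 R) = fst33 s + last33 s.
Proof. by rewrite /form33 /infty33 !vec33E /form22 !mxE; ring. Qed.

Lemma form33_infty_null (R : realType) : form33 (infty33 R) (infty33 R) = 0.
Proof. by rewrite form33_infty /infty33 !vec33E subrr. Qed.

Lemma form33_lift_infty (R : realType) (x : 'cV[R]_4) :
  form33 (lift33 x) (infty33 R) = 1.
Proof. by rewrite form33_infty /lift33 !vec33E; field. Qed.

Lemma mid33_lift (R : realType) (x : 'cV[R]_4) : mid33 (lift33 x) = x.
Proof. by rewrite /lift33 mid33_vec. Qed.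

Lemma form33_lift (R : realType) (x y : 'cV[R]_4) :
  form33 (lift33 x) (lift33 y) = - norm22 (x - y) / 2.
Proof.
by rewrite form33_vec /norm22 /form22 !mxE; field.
Qed.

Lemma form33_lift_null (R : realType) (x : 'cV[R]_4) :
  form33 (lift33 x) (lift33 x) = 0.
Proof. by rewrite form33_vec /norm22; field. Qed.

(** Nullity reads |mid|^2 = (s_5 - s_0)(s_5 + s_0), so once s_0 + s_5 = 1 the middle block
    determines both outer coordinates. *)
Lemma lift33_mid (R : realType) (s : 'cV[R]_(1 + (4 + 1))) :
  form33 s s = 0 -> form33 s (infty33 R) = 1 -> lift33 (mid33 s) = s.
Proof.
rewrite form33_infty {1}/form33 -/(norm22 _) => s0 s1.
rewrite {2}(vec33_eta s) /lift33.
have -> : norm22 (mid33 s) = last33 s - fst33 s.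
  by rewrite -[RHS]mulr1 -s1; lra.
by congr vec33; lra.
Qed.

(** Orthogonality to n means s_5 = - s_0, so the outer terms of the form cancel. *)
Lemma form33_mid (R : realType) (s t : 'cV[R]_(1 + (4 + 1))) :
  form33 s (infty33 R) = 0 -> form33 t (infty33 R) = 0 ->
  form22 (mid33 s) (mid33 t) = form33 s t.
Proof.
rewrite !form33_infty /form33 => /eqP; rewrite addrC addr_eq0 => /eqP ->.
by move/eqP; rewrite addrC addr_eq0 => /eqP ->; ring.
Qed.

(** A difference of two lifts is orthogonal to n. Linear equations on lifts thus become
    orthogonality conditions on displacements in R^{2,2}. *)
Lemma form33_lift_mid (R : realType) (x y : 'cV[R]_4) s :
  form33 s (infty33 R) = 0 ->
  form22 (x - y) (mid33 s) = form33 (lift33 x) s - form33 (lift33 y) s.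
Proof.
move=> s0; rewrite -form33Nl -form33Dl -form33_mid //.
  by rewrite mid33D mid33N !mid33_lift.
by rewrite !form33E !form33_lift_infty subrr.
Qed.

Lemma mid33_eq0 (R : realType) (s : 'cV[R]_(1 + (4 + 1))) :
  form33 s (infty33 R) = 0 -> mid33 s = 0 -> s = fst33 s *: infty33 R.
Proof.
rewrite form33_infty => /eqP; rewrite addrC addr_eq0 => /eqP s5 s0.
rewrite {1}(vec33_eta s) s0 s5 /infty33 /vec33.
by rewrite !scale_col_mx !scale_scalar_mx scaler0 mulr1 mulrN1.
Qed.

Lemma mid33_infty (R : realType) : mid33 (infty33 R) = 0.
Proof. exact: mid33_vec. Qed.

(** * Spans of two vectors and proportional pairs *)

Definition span2 (R : realType) (a b : 'cV[R]_4) : {vspace 'cV[R]_4} :=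
  (<[a]> + <[b]>)%VS.

Lemma span2P (R : realType) (a b v : 'cV[R]_4) :
  reflect (exists x y, v = x *: a + y *: b) (v \in span2 a b).
Proof.
apply: (iffP memv_addP) => [[_ /vlineP[x ->] [_ /vlineP[y ->] ->]]|[x [y ->]]].
  by exists x, y.
by exists (x *: a); [|exists (y *: b) => //]; apply/vlineP; eexists.
Qed.

Lemma dim_span2 (R : realType) (a b : 'cV[R]_4) :
  (forall x y, x *: a + y *: b = 0 -> x = 0 /\ y = 0) ->
  (\dim (span2 a b) = 2)%N.
Proof.
move=> free_ab.
have a0 : a != 0.
  apply/eqP => a0; have [] := free_ab 1 0; last by move/eqP; rewrite oner_eq0.
  by rewrite a0 scaler0 scale0r addr0.
have b0 : b != 0.
  apply/eqP => b0; have [] := free_ab 0 1; last first.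
    by move=> _ /eqP; rewrite oner_eq0.
  by rewrite b0 scaler0 scale0r addr0.
rewrite dimv_disjoint_sum ?dim_vline ?a0 ?b0 //.
apply/eqP; rewrite -subv0; apply/subvP => v /memv_capP[/vlineP[x ->]].
move=> /vlineP[y /eqP]; rewrite -subr_eq0 -scaleNr => /eqP/free_ab[-> _].
by rewrite scale0r mem0v.
Qed.

Lemma proportional (R : realType) (a b x y : R) :
  ~ (x = 0 /\ y = 0) -> y * a = x * b -> exists l, a = l * x /\ b = l * y.
Proof.
move=> xy0 ab; have [x0|x0] := eqVneq x 0; last first.
  exists (a / x); split; first by rewrite divfK.
  by rewrite mulrAC (mulrC a) ab mulrAC divff // mul1r.
have y0 : y != 0 by apply/eqP => y0; apply: xy0.
exists (b / y); split; last by rewrite divfK.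
by move/eqP: ab; rewrite x0 mul0r mulf_eq0 (negPf y0) mulr0 => /eqP.
Qed.

(* The triples span orthogonal 3-spaces of signatures (2,1) and (1,2), in this
   order for [e = 1] and in the opposite order for [e = -1]. *)
Record frame (R : realType) (e : R) (u1 u2 u3 w1 w2 w3 : 'cV[R]_(1 + (4 + 1)))
    : Prop := Frame {
  frame_sign : e * e = 1;
  frame11 : form33 u1 u1 = e;
  frame22 : form33 u2 u2 = e;
  frame33 : form33 u3 u3 = - e;
  frame12 : form33 u1 u2 = 0;
  frame13 : form33 u1 u3 = 0;
  frame23 : form33 u2 u3 = 0;
  frame44 : form33 w1 w1 = - e;
  frame55 : form33 w2 w2 = - e;
  frame66 : form33 w3 w3 = e;
  frame45 : form33 w1 w2 = 0;
  frame46 : form33 w1 w3 = 0;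
  frame56 : form33 w2 w3 = 0;
  frame14 : form33 u1 w1 = 0;
  frame15 : form33 u1 w2 = 0;
  frame16 : form33 u1 w3 = 0;
  frame24 : form33 u2 w1 = 0;
  frame25 : form33 u2 w2 = 0;
  frame26 : form33 u2 w3 = 0;
  frame34 : form33 u3 w1 = 0;
  frame35 : form33 u3 w2 = 0;
  frame36 : form33 u3 w3 = 0;
  frame_expand : forall s,
    s = e *: (form33 s u1 *: u1 + form33 s u2 *: u2 - form33 s u3 *: u3
      - (form33 s w1 *: w1 + form33 s w2 *: w2 - form33 s w3 *: w3))
}.

(** * Frames, their symmetries and their sections *)

(** The two triples are interchangeable: what is proved for one conic passes to the other by this
    swap. *)
Lemma frameC (R : realType) (e : R) u1 u2 u3 w1 w2 w3 :
  frame e u1 u2 u3 w1 w2 w3 -> frame (- e) w1 w2 w3 u1 u2 u3.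
Proof.
case=> *; split; rewrite ?opprK ?mulrNN // 1?form33C // => s.
by rewrite scaleNr -scalerN opprB.
Qed.

(** The products of frame vectors in both orders, bundled as one rewriting rule, so that [ring] can
    finish computations in a frame. *)
Definition frameE (R : realType) (e : R) u1 u2 u3 w1 w2 w3
    (F : frame e u1 u2 u3 w1 w2 w3) :=
  let C u v (h : form33 u v = 0) : form33 v u = 0 :=
    etrans (form33C v u) h in
  ((frame11 F, frame22 F, frame33 F, frame12 F, frame13 F, frame23 F),
   (frame44 F, frame55 F, frame66 F, frame45 F, frame46 F, frame56 F),
   (C _ _ (frame12 F), C _ _ (frame13 F), C _ _ (frame23 F)),
   (C _ _ (frame45 F), C _ _ (frame46 F), C _ _ (frame56 F)),
   (frame14 F, frame15 F, frame16 F, frame24 F, frame25 F, frame26 F,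
    frame34 F, frame35 F, frame36 F),
   (C _ _ (frame14 F), C _ _ (frame15 F), C _ _ (frame16 F),
    C _ _ (frame24 F), C _ _ (frame25 F), C _ _ (frame26 F),
    C _ _ (frame34 F), C _ _ (frame35 F), C _ _ (frame36 F))).

Lemma frame_sign_neq0 (R : realType) (e : R) u1 u2 u3 w1 w2 w3 :
  frame e u1 u2 u3 w1 w2 w3 -> e != 0.
Proof.
move=> F; apply/eqP => e0; move/eqP: (frame_sign F).
by rewrite e0 mulr0 eq_sym oner_eq0.
Qed.

(** For a frame, the triple w1, w2, w3 cuts out the conic whose lifts lie in the span U of u1, u2,
    u3. *)
Definition section3 (R : realType) (w1 w2 w3 : 'cV[R]_(1 + (4 + 1))) :
    set 'cV[R]_4 :=
  [set y | [/\ form33 (lift33 y) w1 = 0, form33 (lift33 y) w2 = 0 &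
               form33 (lift33 y) w3 = 0]].

Lemma frame_rotate_by (R : realType) (e c s : R) u1 u2 u3 w1 w2 w3 :
  c * c + s * s = 1 -> frame e u1 u2 u3 w1 w2 w3 ->
  frame e (c *: u1 + s *: u2) (- s *: u1 + c *: u2) u3 w1 w2 w3.
Proof.
move=> cs F; have E := frameE F.
have ce t : (c * c + s * s) * t = t by rewrite cs mul1r.
split; rewrite ?form33E ?E ?mulr0 ?addr0 ?oppr0 ?add0r ?mulrN ?mulNr ?opprK //.
- exact: frame_sign F.
- by rewrite -[RHS]ce; ring.
- by rewrite -[RHS]ce; ring.
- by ring.
move=> t; rewrite {1}(frame_expand F t).
congr (_ *: (_ - _ - _)); rewrite !form33E.
apply/colP => i; rewrite !mxE -[LHS]ce; ring.
Qed.

Lemma section3_rotate (R : realType) (c s : R) (u1 u2 u3 : 'cV[R]_(1 + (4 + 1))) :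
  c * c + s * s = 1 ->
  section3 (c *: u1 + s *: u2) (- s *: u1 + c *: u2) u3 = section3 u1 u2 u3.
Proof.
move=> cs; apply/seteqP; split=> y [] /=; last first.
  by move=> y1 y2 y3; split; rewrite /= ?form33E ?y1 ?y2 //; ring.
pose a := form33 (lift33 y) u1; pose b := form33 (lift33 y) u2.
rewrite !form33E -/a -/b => y1 y2 y3; split; rewrite -?/a -?/b //.
- have -> : a = c * (c * a + s * b) - s * (- s * a + c * b)
                - (c * c + s * s - 1) * a by ring.
  by rewrite y1 y2 cs; ring.
- have -> : b = s * (c * a + s * b) + c * (- s * a + c * b)
                - (c * c + s * s - 1) * b by ring.
  by rewrite y1 y2 cs; ring.
Qed.

(** The form is e times a Euclidean one on span(u1, u2), so rotations preserve frames there. One of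
    them turns the pair of products with n into (r, 0), where r is its Euclidean length; if r = 0,
    the identity serves. *)
Lemma frame_rotate (R : realType) (e : R) u1 u2 u3 w1 w2 w3 :
  frame e u1 u2 u3 w1 w2 w3 ->
  exists v1 v2, [/\ frame e v1 v2 u3 w1 w2 w3, form33 v2 (infty33 R) = 0 &
    section3 v1 v2 u3 = section3 u1 u2 u3].
Proof.
move=> F; pose x1 := form33 u1 (infty33 R); pose x2 := form33 u2 (infty33 R).
suff [c [s [cs x0]]] : exists c s, c * c + s * s = 1 /\ - s * x1 + c * x2 = 0.
  exists (c *: u1 + s *: u2), (- s *: u1 + c *: u2).
  by rewrite section3_rotate ?form33E //; split=> //; apply: frame_rotate_by.
have x12 : 0 <= x1 ^+ 2 + x2 ^+ 2 by rewrite addr_ge0 ?sqr_ge0.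
pose r := Num.sqrt (x1 ^+ 2 + x2 ^+ 2).
have rr : r ^+ 2 = x1 ^+ 2 + x2 ^+ 2 by rewrite sqr_sqrtr.
have [r0|r0] := eqVneq r 0; last first.
  exists (x1 / r), (x2 / r); split; last by field.
  have -> : x1 / r * (x1 / r) + x2 / r * (x2 / r) = (x1 ^+ 2 + x2 ^+ 2) / r ^+ 2.
    by field.
  by rewrite -rr divff ?expf_neq0.
exists 1, 0; split; first by ring.
move/esym/eqP: rr; rewrite r0 expr0n /= paddr_eq0 ?sqr_ge0 //.
by rewrite !sqrf_eq0 => /andP[_ /eqP ->]; ring.
Qed.

(* For [form33 u2 (infty33 R) = 0], this and [u2] span the vectors of
   span(u1, u2, u3) orthogonal to [infty33 R]. *)
Definition asymptote (R : realType) (u1 u3 : 'cV[R]_(1 + (4 + 1))) :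
    'cV[R]_(1 + (4 + 1)) :=
  form33 u3 (infty33 R) *: u1 - form33 u1 (infty33 R) *: u3.

Lemma form33_asymptote_infty (R : realType) (u1 u3 : 'cV[R]_(1 + (4 + 1))) :
  form33 (asymptote u1 u3) (infty33 R) = 0.
Proof. by rewrite /asymptote !form33E mulrC subrr. Qed.

(** * The direction planes of the two conics *)

Definition frame_dir (R : realType) (u1 u2 u3 : 'cV[R]_(1 + (4 + 1))) :=
  span2 (mid33 u2) (mid33 (asymptote u1 u3)).

(** When u2 is orthogonal to n, this says that the component n1 of n in U is nonzero. *)
Definition meets_infty (R : realType) (u1 u3 : 'cV[R]_(1 + (4 + 1))) : Prop :=
  ~ (form33 u1 (infty33 R) = 0 /\ form33 u3 (infty33 R) = 0).

Lemma frame_dir_orth (R : realType) (e : R) u1 u2 u3 w1 w2 w3 :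
  frame e u1 u2 u3 w1 w2 w3 ->
  form33 u2 (infty33 R) = 0 -> form33 w2 (infty33 R) = 0 ->
  forall u v, u \in frame_dir u1 u2 u3 -> v \in frame_dir w1 w2 w3 ->
  form22 u v = 0.
Proof.
move=> F u20 w20 _ _ /span2P[a [b ->]] /span2P[c [d ->]].
have ainf := form33_asymptote_infty.
rewrite !(form22Dl, form22Dr, form22Zl, form22Zr) !form33_mid //.
by rewrite /asymptote !form33E !(frameE F); ring.
Qed.

(** Lift v to a vector s orthogonal to n. Orthogonality to the first plane makes the products of s
    with u1, u2, u3 proportional to those of n, so s minus a multiple of n lies in U^perp. It is
    still orthogonal to n, hence a combination of w2 and [asymptote w1 w3]. *)
Lemma frame_dir_complement (R : realType) (e : R) u1 u2 u3 w1 w2 w3 :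
  frame e u1 u2 u3 w1 w2 w3 -> meets_infty u1 u3 -> meets_infty w1 w3 ->
  form33 u2 (infty33 R) = 0 -> form33 w2 (infty33 R) = 0 ->
  orthogonal_complement (frame_dir u1 u2 u3) (frame_dir w1 w2 w3).
Proof.
move=> F x0 y0 u20 w20 v; split=> [vE u uD|vD].
  exact: (frame_dir_orth F).
pose s := vec33 0 v 0.
have sinf : form33 s (infty33 R) = 0 by rewrite form33_infty !vec33E addr0.
have sv : mid33 s = v by rewrite mid33_vec.
have su2 : form33 s u2 = 0.
  rewrite -form33_mid // form22C sv; apply: vD; apply/span2P.
  by exists 1, 0; rewrite scale1r scale0r addr0.
have [l [su1 su3]] : exists l, form33 s u1 = l * form33 u1 (infty33 R) /\
    form33 s u3 = l * form33 u3 (infty33 R).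
  apply: proportional => //; apply/eqP; rewrite -subr_eq0; apply/eqP.
  transitivity (form33 s (asymptote u1 u3)); first by rewrite !form33E.
  rewrite -form33_mid // ?form33_asymptote_infty // form22C sv.
  by apply: vD; apply/span2P; exists 0, 1; rewrite scale1r scale0r add0r.
pose t := s - l *: infty33 R.
have tinf : form33 t (infty33 R) = 0.
  by rewrite !form33E sinf form33_infty_null mulr0 subrr.
have tu1 : form33 t u1 = 0.
  by rewrite !form33E su1 (form33C (infty33 R)) subrr.
have tu2 : form33 t u2 = 0.
  by rewrite !form33E su2 (form33C (infty33 R)) u20 mulr0 subrr.
have tu3 : form33 t u3 = 0.
  by rewrite !form33E su3 (form33C (infty33 R)) subrr.
have tw : t = - e *: (form33 t w1 *: w1 + form33 t w2 *: w2 - form33 t w3 *: w3).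
  by rewrite {1}(frame_expand F t) tu1 tu2 tu3 !scale0r !addr0 subrr sub0r
    scalerN scaleNr.
have [m [tw3 tw1]] : exists m, form33 t w3 = m * form33 w1 (infty33 R) /\
    form33 t w1 = m * form33 w3 (infty33 R).
  apply: proportional => [[y3 y1]|]; first by apply: y0.
  apply/eqP; rewrite -subr_eq0; apply/eqP.
  move: tinf; rewrite {1}tw !form33E w20 mulr0 addr0 => /eqP.
  rewrite mulf_eq0 oppr_eq0 (negPf (frame_sign_neq0 F)) => /eqP h.
  by rewrite -oppr0 -h; ring.
apply/span2P; exists (- e * form33 t w2), (- e * m).
have -> : v = mid33 t.
  by rewrite /t mid33D mid33N mid33Z mid33_infty scaler0 oppr0 addr0.
rewrite -!mid33Z -mid33D; congr mid33; rewrite [LHS]tw tw1 tw3 /asymptote.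
by apply/colP => i; rewrite !mxE; ring.
Qed.

(** A vanishing combination in R^{2,2} comes from a vector s of U that is a multiple of n. A nonzero
    multiple would put n in U, against [meets_infty w1 w3]; so s = 0, and products with the frame
    kill the coefficients. *)
Lemma frame_dir_dim (R : realType) (e : R) u1 u2 u3 w1 w2 w3 :
  frame e u1 u2 u3 w1 w2 w3 -> meets_infty u1 u3 -> meets_infty w1 w3 ->
  form33 u2 (infty33 R) = 0 -> form33 w2 (infty33 R) = 0 ->
  (\dim (frame_dir u1 u2 u3) = 2)%N.
Proof.
move=> F x0 y0 u20 w20; apply: dim_span2 => a b.
rewrite -!mid33Z -mid33D; set s := (_ + _) => s0.
have e0 := frame_sign_neq0 F.
have {s0} sl : s = fst33 s *: infty33 R.
  by apply: mid33_eq0 => //; rewrite !form33E u20; ring.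
have l0 : fst33 s = 0.
  apply/eqP/negP => /negP l0; apply: y0.
  have sw w : form33 s w = 0 -> form33 w (infty33 R) = 0.
    rewrite sl form33Zl form33C => /eqP; rewrite mulf_eq0 (negPf l0) => /eqP.
    by [].
  by split; apply: sw; rewrite /s /asymptote !form33E !(frameE F); ring.
have {l0}s0 : s = 0 by rewrite sl l0 scale0r.
have su u : form33 s u = 0 by rewrite s0 -(scale0r 0) form33Zl mul0r.
have ae : a * e = 0.
  by rewrite -(su u2) /s /asymptote !form33E !(frameE F); ring.
have b3 : b * form33 u3 (infty33 R) * e = 0.
  by rewrite -(su u1) /s /asymptote !form33E !(frameE F); ring.
have b1 : b * form33 u1 (infty33 R) * e = 0.
  by rewrite -(su u3) /s /asymptote !form33E !(frameE F); ring.
split; apply/eqP.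
  by move/eqP: ae; rewrite mulf_eq0 (negPf e0) orbF.
apply/negP => /negP b0; apply: x0; split; apply/eqP.
  by move/eqP: b1; rewrite !mulf_eq0 (negPf e0) (negPf b0) orbF.
by move/eqP: b3; rewrite !mulf_eq0 (negPf e0) (negPf b0) orbF.
Qed.

(** The direction is the orthogonal complement of the other direction plane, so the affine plane
    through q is given by two linear equations on lifts. *)
Lemma frame_plane (R : realType) (e : R) u1 u2 u3 w1 w2 w3 q :
  frame e u1 u2 u3 w1 w2 w3 -> meets_infty u1 u3 -> meets_infty w1 w3 ->
  form33 u2 (infty33 R) = 0 -> form33 w2 (infty33 R) = 0 ->
  form33 (lift33 q) w2 = 0 -> form33 (lift33 q) (asymptote w1 w3) = 0 ->
  exists P : plane R, [/\ plane_base P = q, plane_dir P = frame_dir u1 u2 u3 &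
    plane_set P = [set y | form33 (lift33 y) w2 = 0 /\
                           form33 (lift33 y) (asymptote w1 w3) = 0]].
Proof.
move=> F x0 y0 u20 w20 q2 qa.
exists (Plane q (frame_dir_dim F x0 y0 u20 w20)); split=> //=.
have C := frame_dir_complement (frameC F) y0 x0 w20 u20.
have ainf := form33_asymptote_infty w1 w3.
apply/seteqP; split=> y /=; rewrite /plane_set /=.
  move=> /C yD; split; rewrite -[LHS]subr0.
    rewrite -{1}q2 -form33_lift_mid // form22C yD //; apply/span2P.
    by exists 1, 0; rewrite scale1r scale0r addr0.
  rewrite -{1}qa -form33_lift_mid // form22C yD //; apply/span2P.
  by exists 0, 1; rewrite scale1r scale0r add0r.
move=> [y2 ya]; apply/C => _ /span2P[a [b ->]].
rewrite form22C form22Dr !form22Zr !form33_lift_mid //.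
by rewrite y2 ya q2 qa subrr !mulr0 addr0.
Qed.

(** The spanning vectors are orthogonal with norms e and e ((u3, n)^2 - (u1, n)^2); the sign of the
    last difference decides the type of the plane. *)
Lemma frame_dir_norm (R : realType) (e : R) u1 u2 u3 w1 w2 w3 v :
  frame e u1 u2 u3 w1 w2 w3 -> form33 u2 (infty33 R) = 0 ->
  v \in frame_dir u1 u2 u3 ->
  exists a b, v = a *: mid33 u2 + b *: mid33 (asymptote u1 u3) /\
   norm22 v = e * (a ^+ 2 + b ^+ 2 *
     (form33 u3 (infty33 R) ^+ 2 - form33 u1 (infty33 R) ^+ 2)).
Proof.
move=> F u20 /span2P[a [b ->]]; exists a, b; split=> //.
have ainf := form33_asymptote_infty u1 u3.
rewrite /norm22 !(form22Dl, form22Dr, form22Zl, form22Zr) !form33_mid //.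
by rewrite /asymptote !form33E !(frameE F); ring.
Qed.

(** * The conics as sections of hyperspheres and null cones *)

Lemma frame_form (R : realType) (e : R) u1 u2 u3 w1 w2 w3 s t :
  frame e u1 u2 u3 w1 w2 w3 ->
  form33 s t =
    e * (form33 s u1 * form33 u1 t + form33 s u2 * form33 u2 t
         - form33 s u3 * form33 u3 t
         - (form33 s w1 * form33 w1 t + form33 s w2 * form33 w2 t
            - form33 s w3 * form33 w3 t)).
Proof. by move=> F; rewrite {1}(frame_expand F s) !form33E. Qed.

(** This is (n1, n1) + (n2, n2) = (n, n) = 0, expanded in the frame. *)
Lemma frame_infty (R : realType) (e : R) u1 u2 u3 w1 w2 w3 :
  frame e u1 u2 u3 w1 w2 w3 ->
  form33 u2 (infty33 R) = 0 -> form33 w2 (infty33 R) = 0 ->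
  form33 u3 (infty33 R) ^+ 2 - form33 u1 (infty33 R) ^+ 2 =
  form33 w3 (infty33 R) ^+ 2 - form33 w1 (infty33 R) ^+ 2.
Proof.
move=> F u20 w20; have := frame_form (infty33 R) (infty33 R) F.
rewrite form33_infty_null !(form33C (infty33 R)) u20 w20.
move/esym/eqP; rewrite mulf_eq0 (negPf (frame_sign_neq0 F)) => /eqP; lra.
Qed.

(** Expand (s_y, n) = 1 in the frame and multiply by e. *)
Lemma frame_lift (R : realType) (e : R) u1 u2 u3 w1 w2 w3 y :
  frame e u1 u2 u3 w1 w2 w3 ->
  form33 u2 (infty33 R) = 0 -> form33 w2 (infty33 R) = 0 ->
  form33 (lift33 y) u1 * form33 u1 (infty33 R)
    - form33 (lift33 y) u3 * form33 u3 (infty33 R) =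
  form33 (lift33 y) w1 * form33 w1 (infty33 R)
    - form33 (lift33 y) w3 * form33 w3 (infty33 R) + e.
Proof.
move=> F u20 w20; have := frame_form (lift33 y) (infty33 R) F.
rewrite form33_lift_infty u20 w20 => /(congr1 (fun z => e * z)).
by rewrite mulr1 mulrA (frame_sign F) mul1r; lra.
Qed.

(** In the frame k = - e d, so the hypothesis on p reads s_p = (n1 - n2) / (2k), and e / d is the
    radius-square - 1/k. Since |y - p|^2 = (e + 2 b) / d with b affine in y, the hypersphere adds
    the one linear equation b = 0. *)
Lemma hypersphere_section (R : realType) (e : R) u1 u2 u3 w1 w2 w3 p :
  frame e u1 u2 u3 w1 w2 w3 ->
  form33 u2 (infty33 R) = 0 -> form33 w2 (infty33 R) = 0 ->
  let d := form33 w3 (infty33 R) ^+ 2 - form33 w1 (infty33 R) ^+ 2 in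
  d != 0 ->
  lift33 p = - (2 * d)^-1 *:
    (form33 u1 (infty33 R) *: u1 - form33 u3 (infty33 R) *: u3
     + (form33 w1 (infty33 R) *: w1 - form33 w3 (infty33 R) *: w3)) ->
  section3 w1 w2 w3 =
  [set y | form33 (lift33 y) w2 = 0 /\
           form33 (lift33 y) (asymptote w1 w3) = 0] `&` hypersphere p (e / d).
Proof.
move=> F u20 w20 d d0 pE.
pose b y := form33 (lift33 y) w1 * form33 w1 (infty33 R)
            - form33 (lift33 y) w3 * form33 w3 (infty33 R).
have normE y : norm22 (y - p) = (e + 2 * b y) / d.
  have -> : norm22 (y - p) = - 2 * form33 (lift33 y) (lift33 p).
    by rewrite form33_lift; field.
  have := frame_lift y F u20 w20; rewrite -/(b y) => h.
  rewrite pE !form33E.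
  have -> : form33 u1 (infty33 R) * form33 (lift33 y) u1 =
            b y + e + form33 u3 (infty33 R) * form33 (lift33 y) u3.
    by rewrite -h; ring.
  by rewrite /b; field.
have asymE y : form33 (lift33 y) (asymptote w1 w3) =
    form33 w3 (infty33 R) * form33 (lift33 y) w1
    - form33 w1 (infty33 R) * form33 (lift33 y) w3 by rewrite !form33E.
apply/seteqP; split=> y /=; rewrite /hypersphere /=.
  case=> y1 y2 y3; split; first by rewrite asymE y1 y2 y3 !mulr0 subrr.
  by rewrite normE /b y1 y3; ring.
case=> -[y2]; rewrite asymE normE => y13.
move=> /(congr1 (fun z => z * d)); rewrite !divfK // => h.
have {h} by0 : b y = 0 by lra.
(* The equation of [asymptote] and b = 0 form a linear system in the products with w1 and w3, of
   determinant - d; Cramer's rule gives both products. *)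
split=> //; apply: (mulfI d0); rewrite mulr0.
  transitivity (form33 w3 (infty33 R) * 0 - form33 w1 (infty33 R) * b y).
    by rewrite -y13 /b /d; ring.
  by rewrite by0; ring.
transitivity (form33 w1 (infty33 R) * 0 - form33 w3 (infty33 R) * b y).
  by rewrite -y13 /b /d; ring.
by rewrite by0; ring.
Qed.

(** Up to sign |y - p|^2 is the sum of (s_y, w1) / y1 and (s_y, w3) / y3. The equation of
    [asymptote] makes these two terms equal, so on the cone both vanish. *)
Lemma null_cone_section (R : realType) (w1 w2 w3 : 'cV[R]_(1 + (4 + 1))) p :
  let y1 := form33 w1 (infty33 R) in let y3 := form33 w3 (infty33 R) in
  y1 != 0 -> y1 ^+ 2 = y3 ^+ 2 ->
  lift33 p = (2 * y1)^-1 *: w1 + (2 * y3)^-1 *: w3 ->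
  section3 w1 w2 w3 =
  [set y | form33 (lift33 y) w2 = 0 /\
           form33 (lift33 y) (asymptote w1 w3) = 0] `&` null_cone p.
Proof.
move=> y1 y3 y10 y13 pE.
have y30 : y3 != 0 by rewrite -sqrf_eq0 -y13 sqrf_eq0.
have normE y : norm22 (y - p) =
    - (form33 (lift33 y) w1 / y1 + form33 (lift33 y) w3 / y3).
  have -> : norm22 (y - p) = - 2 * form33 (lift33 y) (lift33 p).
    by rewrite form33_lift; field.
  by rewrite pE !form33E; field; rewrite y30.
have asymE y : form33 (lift33 y) (asymptote w1 w3) =
    y3 * form33 (lift33 y) w1 - y1 * form33 (lift33 y) w3 by rewrite !form33E.
apply/seteqP; split=> y /=; rewrite /null_cone /=.
  case=> h1 h2 h3; split; first by rewrite asymE h1 h2 h3 !mulr0 subrr.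
  by rewrite normE h1 h3 !mul0r addr0 oppr0.
case=> -[h2]; rewrite asymE normE => ha hn.
have e13 : form33 (lift33 y) w3 / y3 = form33 (lift33 y) w1 / y1.
  have h : y1 * form33 (lift33 y) w1 = y3 * form33 (lift33 y) w3.
    apply: (mulfI y10); rewrite mulrA -expr2 y13 -[RHS]add0r -(mulr0 y3) -ha.
    by ring.
  transitivity (y3 * form33 (lift33 y) w3 / y3 ^+ 2); first by field.
  by rewrite -h -y13; field.
have h1 : form33 (lift33 y) w1 / y1 = 0 by move: hn; rewrite e13; lra.
split=> //; apply/eqP.
  by move/eqP: h1; rewrite mulf_eq0 invr_eq0 (negPf y10) orbF.
by move/eqP: h1; rewrite -e13 mulf_eq0 invr_eq0 (negPf y30) orbF.
Qed.

(** Here n lies in U^perp. A point with lift in U would have (s_y, n) = 0 instead of 1, so one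
    section is empty. In U^perp the lifts form a parabola in the direction w2 with axis n, and
    [mid33] flattens it to a line. *)
Lemma frame_line (R : realType) (e : R) u1 u2 u3 w1 w2 w3 :
  frame e u1 u2 u3 w1 w2 w3 ->
  form33 u2 (infty33 R) = 0 -> form33 w2 (infty33 R) = 0 ->
  form33 u1 (infty33 R) = 0 -> form33 u3 (infty33 R) = 0 ->
  is_line (section3 u1 u2 u3) /\ section3 w1 w2 w3 = set0.
Proof.
move=> F u20 w20 u10 u30; have e0 := frame_sign_neq0 F.
set y1 := form33 w1 (infty33 R); set y3 := form33 w3 (infty33 R).
have y13 : y1 ^+ 2 = y3 ^+ 2.
  by apply/eqP; rewrite eq_sym -subr_eq0 -(frame_infty F) // u10 u30 subrr.
have liftE y : e * (y1 * form33 (lift33 y) w1 - y3 * form33 (lift33 y) w3) = - 1.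
  have := frame_lift y F u20 w20; rewrite u10 u30 !mulr0 subrr -/y1 -/y3.
  by rewrite -(frame_sign F) => h; rewrite -[RHS]addr0 -(mulr0 e) h; ring.
have y10 : y1 != 0.
  apply/eqP => y10; have y30 : y3 = 0.
    by apply/eqP; rewrite -sqrf_eq0 -y13 y10 expr0n.
  by move/eqP: (liftE 0); rewrite y10 y30 !mul0r subrr mulr0 eq_sym oppr_eq0 oner_eq0.
have y30 : y3 != 0 by rewrite -sqrf_eq0 -y13 sqrf_eq0.
split; last first.
  apply/seteqP; split=> // y [h1 h2 h3]; have /eqP := liftE y.
  by rewrite h1 h3 !mulr0 subrr mulr0 eq_sym oppr_eq0 oner_eq0.
(* The null vector of span(w1, w3) with (t, n) = 1: the lift of the base point of the line. *)
pose t := (2 * y1)^-1 *: w1 + (2 * y3)^-1 *: w3.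
have tinf : form33 t (infty33 R) = 1.
  by rewrite !form33E -/y1 -/y3; field; rewrite y30.
have w2m : norm22 (mid33 w2) = - e by rewrite /norm22 form33_mid ?(frameE F).
have mid13 : mid33 w1 = (y3 / y1) *: mid33 w3.
  have ninf : y1 *: w1 - y3 *: w3 = - e *: infty33 R.
    rewrite (frame_expand F (infty33 R)) !(form33C (infty33 R)).
    rewrite u10 u20 u30 w20 -/y1 -/y3 !scale0r !addr0 subrr sub0r.
    by rewrite !scalerN scaleNr opprK scalerA (frame_sign F) scale1r.
  have := congr1 (@mid33 R) ninf.
  rewrite mid33D mid33N !mid33Z mid33_infty scaler0 => /eqP; rewrite subr_eq0.
  move/eqP/(congr1 (fun v => y1^-1 *: v)); rewrite !scalerA mulVf // scale1r.
  by rewrite mulrC.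
exists (mid33 t), (mid33 w2); split.
  apply/eqP => w0; move/eqP: w2m; rewrite w0 /norm22 -(scale0r 0) form22Zl mul0r.
  by rewrite eq_sym oppr_eq0 (negPf e0).
apply/seteqP; split=> y /=.
  (* The parameter is the coefficient of w2 in the expansion of the lift. As [mid33 w1] is a
     multiple of [mid33 w3], it remains to see that the other terms and t both project to y3^-1
     times [mid33 w3]. *)
  case=> h1 h2 h3; exists (- e * form33 (lift33 y) w2).
  rewrite -[LHS]mid33_lift [in LHS](frame_expand F (lift33 y)) h1 h2 h3 /t.
  rewrite !(mid33D, mid33N, mid33Z) mid13.
  have := liftE y; set A := form33 _ w1; set B := form33 _ w2; set C := form33 _ w3.
  move=> hAC; have AC : e * (y3 * A / y1 - C) = - y3^-1.
    have -> : y3 * A / y1 = y1 * A / y3.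
      transitivity (y3 ^+ 2 * A / (y1 * y3)); first by field; rewrite y30.
      by rewrite -y13; field; rewrite y30.
    by rewrite -[RHS]mulN1r -hAC; field.
  rewrite !scalerA -scalerDl.
  have -> : (2 * y1)^-1 * (y3 / y1) + (2 * y3)^-1 = y3^-1.
    have -> : (2 * y1)^-1 * (y3 / y1) = y3 / (2 * y1 ^+ 2) by field.
    by rewrite y13; field.
  rewrite -[y3^-1]opprK -AC; apply/colP => i; rewrite !mxE; field.
  by [].
(* The coefficient of n makes s null: it offsets the norm - e l^2 of l w2. *)
case=> l yE; pose s := t + l *: w2 + (e * l ^+ 2 / 2) *: infty33 R.
have ys : lift33 y = s.
  rewrite yE -(mid33Z l) -mid33D.
  have -> : mid33 (t + l *: w2) = mid33 s.
    by rewrite /s [in RHS]mid33D mid33Z mid33_infty scaler0 addr0.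
  apply: lift33_mid; rewrite /s; last first.
    by rewrite 2!form33Dl tinf !form33Zl w20 form33_infty_null !mulr0 !addr0.
  rewrite !form33E !(form33C (infty33 R)) form33_infty_null w20 -/y1 -/y3.
  rewrite !(frameE F).
  transitivity ((e / 4) * ((y3 ^+ 2)^-1 - (y1 ^+ 2)^-1)); last first.
    by rewrite y13 subrr mulr0.
  by field; rewrite y10 y30.
rewrite /section3 /= ys /s /t !form33E !(form33C (infty33 R)) u10 u20 u30.
by rewrite !(frameE F) !mulr0 !addr0.
Qed.

(** * Definite, indefinite and degenerate direction planes *)

Lemma definite_planeP (R : realType) (e d : R) u1 u2 u3 w1 w2 w3 P :
  frame e u1 u2 u3 w1 w2 w3 -> form33 u2 (infty33 R) = 0 ->
  d = form33 u3 (infty33 R) ^+ 2 - form33 u1 (infty33 R) ^+ 2 -> 0 < d ->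
  plane_dir P = frame_dir u1 u2 u3 -> definite_plane P.
Proof.
move=> F u20 dE d0 PE; rewrite /definite_plane PE.
have pos v : v \in frame_dir u1 u2 u3 -> v != 0 -> 0 < e * norm22 v.
  move=> /(frame_dir_norm F u20)[a [b [vE ->]]] v0; rewrite -dE.
  rewrite mulrA (frame_sign F) mul1r.
  have a_ge0 : 0 <= a ^+ 2 by exact: sqr_ge0.
  have b_ge0 : 0 <= b ^+ 2 * d by rewrite mulr_ge0 ?sqr_ge0 ?ltW.
  rewrite lt_def addr_ge0 // andbT paddr_eq0 // sqrf_eq0 mulf_eq0 sqrf_eq0.
  rewrite (gt_eqF d0) orbF; apply: contra v0 => /andP[/eqP a0 /eqP b0].
  by rewrite vE a0 b0 !scale0r addr0.
have /eqP := frame_sign F; rewrite -expr2 sqrf_eq1 => /orP[]/eqP e1.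
  by left=> v vD v0; have := pos v vD v0; rewrite e1 mul1r.
by right=> v vD v0; have := pos v vD v0; rewrite e1 mulN1r oppr_gt0.
Qed.

(** The spanning vectors are orthogonal with norms e and e d of opposite signs; pairing with each of
    them excludes a radical. *)
Lemma indefinite_planeP (R : realType) (e d : R) u1 u2 u3 w1 w2 w3 P :
  frame e u1 u2 u3 w1 w2 w3 -> form33 u2 (infty33 R) = 0 ->
  d = form33 u3 (infty33 R) ^+ 2 - form33 u1 (infty33 R) ^+ 2 -> d < 0 ->
  plane_dir P = frame_dir u1 u2 u3 -> indefinite_plane P.
Proof.
move=> F u20 dE d0 PE; have e0 := frame_sign_neq0 F.
have ainf := form33_asymptote_infty u1 u3.
have m1 : form22 (mid33 u2) (mid33 u2) = e by rewrite form33_mid ?(frameE F).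
have m2 : form22 (mid33 (asymptote u1 u3)) (mid33 (asymptote u1 u3)) = e * d.
  by rewrite form33_mid // dE /asymptote !form33E !(frameE F); ring.
have m12 : form22 (mid33 u2) (mid33 (asymptote u1 u3)) = 0.
  by rewrite form33_mid // /asymptote !form33E !(frameE F); ring.
have D1 : mid33 u2 \in plane_dir P.
  by rewrite PE; apply/span2P; exists 1, 0; rewrite scale1r scale0r addr0.
have D2 : mid33 (asymptote u1 u3) \in plane_dir P.
  by rewrite PE; apply/span2P; exists 0, 1; rewrite scale1r scale0r add0r.
have signs : exists u v, [/\ u \in plane_dir P, v \in plane_dir P,
    0 < norm22 u & norm22 v < 0].
  have /eqP := frame_sign F; rewrite -expr2 sqrf_eq1 => /orP[]/eqP e1.
    exists (mid33 u2), (mid33 (asymptote u1 u3)).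
    by rewrite /norm22 m1 m2 e1 mul1r; split.
  exists (mid33 (asymptote u1 u3)), (mid33 u2).
  by rewrite /norm22 m1 m2 e1 mulN1r oppr_gt0 oppr_lt0 ltr01; split.
case: signs => u [v [uD vD u_gt0 v_lt0]].
split; [|by exists u|by exists v].
case=> z [zD z0 orth]; move: zD; rewrite PE => /span2P[a [b zE]].
have a0 : a = 0.
  have := orth _ D1; rewrite zE form22Dl !form22Zl m1 (form22C (mid33 (_ _ _))).
  rewrite m12 mulr0 addr0 => /eqP.
  by rewrite mulf_eq0 (negPf e0) orbF => /eqP.
have b0 : b = 0.
  have := orth _ D2; rewrite zE form22Dl !form22Zl m2 m12 mulr0 add0r => /eqP.
  by rewrite !mulf_eq0 (negPf e0) (lt_eqF d0) !orbF => /eqP.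
by move: z0; rewrite zE a0 b0 !scale0r addr0 eqxx.
Qed.

(** The projected [asymptote] spans the radical; it is nonzero because the plane has dimension 2. *)
Lemma degenerate_planeP (R : realType) (e : R) u1 u2 u3 w1 w2 w3 P :
  frame e u1 u2 u3 w1 w2 w3 -> form33 u2 (infty33 R) = 0 ->
  form33 u1 (infty33 R) ^+ 2 = form33 u3 (infty33 R) ^+ 2 ->
  plane_dir P = frame_dir u1 u2 u3 -> degenerate_plane P.
Proof.
move=> F u20 x13 PE; have ainf := form33_asymptote_infty u1 u3.
exists (mid33 (asymptote u1 u3)); split.
- by rewrite PE; apply/span2P; exists 0, 1; rewrite scale1r scale0r add0r.
- apply/eqP => a0; have := plane_dim P; rewrite PE /frame_dir a0 /span2.
  have /addv_idPl -> : (<[0 : 'cV[R]_4]> <= <[mid33 u2]>)%VS.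
    by rewrite -memvE mem0v.
  by rewrite dim_vline; case: (_ != 0).
move=> _ /[!PE] /span2P[a [b ->]].
rewrite form22Dr !form22Zr !form33_mid // /asymptote !form33E !(frameE F).
transitivity
  (b * e * (form33 u3 (infty33 R) ^+ 2 - form33 u1 (infty33 R) ^+ 2)); first by ring.
by rewrite x13 subrr mulr0.
Qed.

(** * From conformal images to frames *)

Lemma form33_suml (R : realType) (I : finType) (f : I -> 'cV[R]_(1 + (4 + 1))) t :
  form33 (\sum_i f i) t = \sum_i form33 (f i) t.
Proof.
apply: (big_morph (fun s => form33 s t)) => [x y|]; first by rewrite form33Dl.
by rewrite -(scale0r 0) form33Zl mul0r.
Qed.

Lemma form33_gram (R : realType) (s t : 'cV[R]_(1 + (4 + 1))) :
  form33 s t = (s^T *m gram33 R *m t) 0 0.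
Proof.
have expand (w : 'cV[R]_(1 + (4 + 1))) : w = \sum_i w i 0 *: delta_mx i 0.
  rewrite {1}(matrix_sum_delta w); apply: eq_bigr => i _.
  by rewrite big_ord_recl big_ord0 addr0.
rewrite mxE {1}(expand t) form33C form33_suml; apply: eq_bigr => j _.
rewrite mxE form33Zl mulrC form33C {1}(expand s) form33_suml; congr (_ * _).
by apply: eq_bigr => i _; rewrite form33Zl !mxE.
Qed.

Lemma form33_isometry (R : realType) (e : R) (L : 'M[R]_(1 + (4 + 1))) s t :
  L^T *m gram33 R *m L = e *: gram33 R ->
  form33 (L *m s) (L *m t) = e * form33 s t.
Proof.
move=> LJ; rewrite !form33_gram trmx_mul.
have -> : s^T *m L^T *m gram33 R *m (L *m t)
    = s^T *m (L^T *m gram33 R *m L) *m t by rewrite !mulmxA.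
by rewrite LJ -scalemxAr -scalemxAl mxE.
Qed.

Lemma forall_ord4 (P : 'I_4 -> Prop) : P 0 -> P 1 -> P 2 -> P 3 -> forall i, P i.
Proof.
move=> P0 P1 P2 P3 [[|[|[|[|//]]]] lt_i].
- by rewrite (_ : Ordinal _ = 0) //; apply: val_inj.
- by rewrite (_ : Ordinal _ = 1) //; apply: val_inj.
- by rewrite (_ : Ordinal _ = 2) //; apply: val_inj.
- by rewrite (_ : Ordinal _ = 3) //; apply: val_inj.
Qed.

(** The standard basis, sorted as e1, e2, e5 for W and e3, e4, e0 for W^perp. *)
Lemma standard_frame (R : realType) :
  frame (1 : R) (vec33 0 (delta_mx 0 0) 0) (vec33 0 (delta_mx 1 0) 0)
    (vec33 0 0 1) (vec33 0 (delta_mx 2 0) 0) (vec33 0 (delta_mx 3 0) 0)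
    (vec33 1 0 0).
Proof.
split; rewrite ?form33_vec /form22 ?mxE /=; try ring.
move=> s; rewrite (vec33_eta s); move: (fst33 s) (mid33 s) (last33 s) => a x b.
rewrite !form33_vec scale1r /form22 /vec33.
do 4!rewrite ?scale_col_mx ?scale_scalar_mx ?opp_col_mx ?add_col_mx.
congr col_mx; last congr col_mx; apply/colP.
- by move=> i; rewrite !mxE !ord1 /=; ring.
- by apply: forall_ord4; rewrite !mxE /=; ring.
- by move=> i; rewrite !mxE !ord1 /=; ring.
Qed.

Lemma frame_image (R : realType) (e : R) (L : 'M[R]_(1 + (4 + 1)))
    u1 u2 u3 w1 w2 w3 :
  e * e = 1 -> L \in unitmx -> L^T *m gram33 R *m L = e *: gram33 R ->
  frame 1 u1 u2 u3 w1 w2 w3 ->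
  frame e (L *m u1) (L *m u2) (L *m u3) (L *m w1) (L *m w2) (L *m w3).
Proof.
move=> ee Lu LJ F.
split; rewrite ?(form33_isometry _ _ LJ) ?(frameE F) ?mulr0 ?mulrN1 ?mulr1 //.
move=> s; rewrite -(mulKVmx Lu s); move: (invmx L *m s) => t.
rewrite !(form33_isometry _ _ LJ) {1}(frame_expand F t) scale1r.
rewrite !(mulmxDr, mulmxN) -!scalemxAr.
move: (L *m u1) (L *m u2) (L *m u3) (L *m w1) (L *m w2) (L *m w3).
move=> v1 v2 v3 v4 v5 v6; apply/colP => i; rewrite -[LHS]mul1r -ee !mxE; ring.
Qed.

(* On a cone [K] without null vectors at infinity, every null vector is a
   multiple of the lift of a point. *)
Lemma conformal_imageE (R : realType) (L : 'M[R]_(1 + (4 + 1)))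
    (K : 'cV[R]_(1 + (4 + 1)) -> Prop) (e : R) :
  e * e = 1 -> L \in unitmx -> L^T *m gram33 R *m L = e *: gram33 R ->
  (forall c s, c != 0 -> K s -> K (c *: s)) ->
  (forall s, K s -> form33 s s = 0 -> form33 s (infty33 R) = 0 -> s = 0) ->
  conformal_image L [set x | K (lift33 x)] =
  [set y | K (invmx L *m lift33 y)].
Proof.
move=> ee Lu LJ KZ Kinf; apply/seteqP; split=> y /=.
  case=> x [/= Kx _ [c [c0 ->]]].
  by rewrite -scalemxAr mulKmx //; apply: KZ.
set t := invmx L *m lift33 y => Kt.
have Lt : L *m t = lift33 y by rewrite mulKVmx.
have t0 : form33 t t = 0.
  by rewrite -[LHS]mul1r -ee -mulrA -(form33_isometry _ _ LJ) Lt form33_lift_null mulr0.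
have tinf : form33 t (infty33 R) != 0.
  apply/eqP => /(Kinf _ Kt t0) t_eq0; have := form33_lift_infty y.
  rewrite -Lt t_eq0 mulmx0 -(scale0r 0) form33Zl mul0r => /eqP.
  by rewrite eq_sym oner_eq0.
(* Dividing t by its product with n normalises it to the lift of the preimage of y. *)
pose c := form33 t (infty33 R).
have xE : lift33 (mid33 (c^-1 *: t)) = c^-1 *: t.
  by apply: lift33_mid; rewrite !form33E ?t0 ?mulr0 // mulVf.
exists (mid33 (c^-1 *: t)); split => /=.
- by rewrite xE; apply: KZ; rewrite // invr_eq0.
- rewrite /sent_to_infinity xE -form33_infty -scalemxAr Lt form33Zl.
  by rewrite form33_lift_infty mulr1 => /eqP; rewrite invr_eq0 (negPf tinf).
- by exists c; split=> //; rewrite xE -scalemxAr Lt scalerA divff // scale1r.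
Qed.

(** The product of a lift with e0 is (1 - |x|^2) / 2, which gives the equation of the circle. *)
Lemma circle0E (R : realType) :
  @circle0 R = [set x | [/\ form33 (lift33 x) (vec33 0 (delta_mx 2 0) 0) = 0,
    form33 (lift33 x) (vec33 0 (delta_mx 3 0) 0) = 0 &
    form33 (lift33 x) (vec33 1 0 0) = 0]].
Proof.
apply/seteqP; split=> x; rewrite /circle0 /= !form33_vec.
  rewrite /norm22 /form22 !mxE /= => -[x01 x2 x3].
  by rewrite x2 x3; split; try ring; lra.
rewrite /norm22 /form22 !mxE /= => -[h1 h2 h3].
have x2 : x 2 0 = 0 by lra.
have x3 : x 3 0 = 0 by lra.
by split=> //; move: h3; rewrite x2 x3; lra.
Qed.

Lemma circle0_perpE (R : realType) :
  @circle0_perp R = [set x | [/\ form33 (lift33 x) (vec33 0 (delta_mx 0 0) 0) = 0,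
    form33 (lift33 x) (vec33 0 (delta_mx 1 0) 0) = 0 &
    form33 (lift33 x) (vec33 0 0 1) = 0]].
Proof.
apply/seteqP; split=> x; rewrite /circle0_perp /= !form33_vec.
  rewrite /norm22 /form22 !mxE /= => -[x0 x1 x23].
  by rewrite x0 x1; split; try ring; lra.
rewrite /norm22 /form22 !mxE /= => -[h1 h2 h3].
have x0 : x 0 0 = 0 by lra.
have x1 : x 1 0 = 0 by lra.
by split=> //; move: h3; rewrite x0 x1; lra.
Qed.

(** Such an s lies in span(u1, u2), where the form is definite. *)
Lemma frame_no_null_infty (R : realType) (e : R) u1 u2 u3 w1 w2 w3 s :
  frame e u1 u2 u3 w1 w2 w3 ->
  [/\ form33 s w1 = 0, form33 s w2 = 0 & form33 s w3 = 0] ->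
  form33 s u3 = 0 -> form33 s s = 0 -> s = 0.
Proof.
move=> F [w10 w20 w30] u30; rewrite (frame_form s s F) w10 w20 w30 u30 !mul0r.
rewrite !(form33C _ s) => /eqP; rewrite mulf_eq0 (negPf (frame_sign_neq0 F)).
rewrite addr0 !subr0 paddr_eq0 -?expr2 ?sqr_ge0 // !sqrf_eq0 => /andP[/eqP u10 /eqP u20].
by rewrite (frame_expand F s) w10 w20 w30 u10 u20 u30 !scale0r !addr0 !subr0 scaler0.
Qed.

Lemma conjugate_conics_frame (R : realType) (S S' : set 'cV[R]_4) :
  conjugate_conics S S' ->
  exists (e : R) u1 u2 u3 w1 w2 w3, [/\ frame e u1 u2 u3 w1 w2 w3,
    S = section3 w1 w2 w3 & S' = section3 u1 u2 u3].
Proof.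
case=> L [[Lu LJ] -> ->].
have [e [ee {}LJ]] : exists e, e * e = 1 /\ L^T *m gram33 R *m L = e *: gram33 R.
  case: LJ => ->; [exists 1|exists (-1)].
    by rewrite mulr1 scale1r.
  by rewrite mulrNN mulr1 scaleN1r.
have F := standard_frame R; have FL := frame_image ee Lu LJ F.
have sectionE f1 f2 f3 : section3 (L *m f1) (L *m f2) (L *m f3) =
    [set y | [/\ form33 (invmx L *m lift33 y) f1 = 0,
      form33 (invmx L *m lift33 y) f2 = 0 &
      form33 (invmx L *m lift33 y) f3 = 0]].
  have e0 := frame_sign_neq0 FL.
  have E y f : (form33 (lift33 y) (L *m f) = 0) =
      (form33 (invmx L *m lift33 y) f = 0).
    rewrite -{1}[lift33 y](mulKVmx Lu) (form33_isometry _ _ LJ).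
    apply/propext; split=> [/eqP|->]; last by rewrite mulr0.
    by rewrite mulf_eq0 (negPf e0) => /eqP.
  by apply/seteqP; split=> y; rewrite /section3 /= !E.
have KZ f1 f2 f3 c (s : 'cV[R]_(1 + (4 + 1))) : c != 0 ->
  [/\ form33 s f1 = 0, form33 s f2 = 0 & form33 s f3 = 0] ->
  [/\ form33 (c *: s) f1 = 0, form33 (c *: s) f2 = 0 & form33 (c *: s) f3 = 0].
  by move=> _ [h1 h2 h3]; rewrite !form33Zl h1 h2 h3 mulr0.
(* Since n = e0 - e5, on W or W^perp only the product with the third vector of the triple is left,
   and [frame_no_null_infty] applies. *)
have inftyE s : form33 s (infty33 R) =
    form33 s (vec33 1 0 0) - form33 s (vec33 0 0 1).
  by rewrite form33_infty /form33 !vec33E /form22 !mxE; ring.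
exists e; do 6!eexists; split; first exact: FL.
- rewrite sectionE circle0E; apply: (conformal_imageE ee Lu LJ (@KZ _ _ _)).
  move=> s sK s0; rewrite inftyE; case: (sK) => _ _ ->.
  by rewrite sub0r => /eqP; rewrite oppr_eq0 => /eqP /(frame_no_null_infty F sK); apply.
- rewrite sectionE circle0_perpE; apply: (conformal_imageE ee Lu LJ (@KZ _ _ _)).
  move=> s sK s0; rewrite inftyE; case: (sK) => _ _ ->.
  by rewrite subr0 => /(frame_no_null_infty (frameC F) sK); apply.
Qed.

(** * The central and the parabolic case *)

(** A displacement y - p in both directions is orthogonal to the first direction plane that contains
    it, and this plane is nondegenerate. *)
Lemma plane_set_meet (R : realType) (e : R) u1 u2 u3 w1 w2 w3 P P' p :
  frame e u1 u2 u3 w1 w2 w3 ->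
  form33 u2 (infty33 R) = 0 -> form33 w2 (infty33 R) = 0 ->
  form33 u1 (infty33 R) ^+ 2 != form33 u3 (infty33 R) ^+ 2 ->
  plane_base P = p -> plane_base P' = p ->
  plane_dir P = frame_dir u1 u2 u3 -> plane_dir P' = frame_dir w1 w2 w3 ->
  plane_set P `&` plane_set P' = [set p].
Proof.
move=> F u20 w20 d0 Pp P'p PD P'D; have e0 := frame_sign_neq0 F.
apply/seteqP; split=> y; rewrite /plane_set /= Pp P'p PD P'D; last first.
  by move=> ->; rewrite subrr !mem0v.
have ainf := form33_asymptote_infty u1 u3.
case=> /span2P[a [b vE]] /(frame_dir_orth F u20 w20) orth.
have {orth} : form22 (mid33 u2) (y - p) = 0 /\
    form22 (mid33 (asymptote u1 u3)) (y - p) = 0.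
  split; apply: orth; apply/span2P.
    by exists 1, 0; rewrite scale1r scale0r addr0.
  by exists 0, 1; rewrite scale1r scale0r add0r.
rewrite vE !form22Dr !form22Zr !form33_mid // /asymptote !form33E !(frameE F).
case=> h1 h2.
have a0 : a = 0 by apply: (mulIf e0); rewrite mul0r -h1; ring.
have b0 : b = 0.
  apply: (mulIf e0); apply: (mulIf (_ : form33 u3 (infty33 R) ^+ 2
    - form33 u1 (infty33 R) ^+ 2 != 0)); first by rewrite subr_eq0 eq_sym.
  by rewrite !mul0r -h2; ring.
by apply/eqP; rewrite -subr_eq0 vE a0 b0 !scale0r addr0.
Qed.

Lemma frame_central (R : realType) (e : R) u1 u2 u3 w1 w2 w3 :
  frame e u1 u2 u3 w1 w2 w3 ->
  form33 u2 (infty33 R) = 0 -> form33 w2 (infty33 R) = 0 ->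
  form33 u1 (infty33 R) ^+ 2 != form33 u3 (infty33 R) ^+ 2 ->
  exists P P' : plane R,
    [/\ complementary P P',
        definite_plane P /\ definite_plane P' \/
        indefinite_plane P /\ indefinite_plane P' &
        concentric_sections (section3 w1 w2 w3) (section3 u1 u2 u3) P P'].
Proof.
move=> F u20 w20 x13; have e0 := frame_sign_neq0 F; have FC := frameC F.
have dE := frame_infty F u20 w20.
pose d := form33 w3 (infty33 R) ^+ 2 - form33 w1 (infty33 R) ^+ 2.
have d0 : d != 0 by rewrite /d -dE subr_eq0 eq_sym.
have ux : meets_infty u1 u3 by case=> h1 h3; rewrite h1 h3 eqxx in x13.
have wx : meets_infty w1 w3 by case=> h1 h3; rewrite /d h1 h3 subrr eqxx in d0.
pose t := - (2 * d)^-1 *: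
  (form33 u1 (infty33 R) *: u1 - form33 u3 (infty33 R) *: u3
   + (form33 w1 (infty33 R) *: w1 - form33 w3 (infty33 R) *: w3)).
have pE : lift33 (mid33 t) = t.
  apply: lift33_mid; rewrite /t !form33E ?(frameE F).
    transitivity ((2 * d)^-1 ^+ 2 * e * ((form33 w3 (infty33 R) ^+ 2
      - form33 w1 (infty33 R) ^+ 2) - (form33 u3 (infty33 R) ^+ 2
      - form33 u1 (infty33 R) ^+ 2))); first by ring.
    by rewrite dE subrr mulr0.
  transitivity ((2 * d)^-1 * (form33 w3 (infty33 R) ^+ 2
      - form33 w1 (infty33 R) ^+ 2 + (form33 u3 (infty33 R) ^+ 2
      - form33 u1 (infty33 R) ^+ 2))); first by ring.
  by rewrite dE -/d; field.
set p := mid33 t in pE.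
have pE' : lift33 p = - (2 * d)^-1 *:
  (form33 w1 (infty33 R) *: w1 - form33 w3 (infty33 R) *: w3
   + (form33 u1 (infty33 R) *: u1 - form33 u3 (infty33 R) *: u3)).
  by rewrite pE /t addrC.
have [P [Pp PD PS]] := @frame_plane R e u1 u2 u3 w1 w2 w3 p F ux wx u20 w20
  ltac:(by rewrite pE /t !form33E !(frameE F); ring)
  ltac:(by rewrite pE /t /asymptote !form33E !(frameE F); ring).
have [P' [P'p P'D P'S]] := @frame_plane R _ w1 w2 w3 u1 u2 u3 p FC wx ux w20 u20
  ltac:(by rewrite pE /t !form33E !(frameE F); ring)
  ltac:(by rewrite pE /t /asymptote !form33E !(frameE F); ring).
have SE := hypersphere_section F u20 w20 d0 pE.
have S'E : section3 u1 u2 u3 = plane_set P' `&` hypersphere p (- (e / d)).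
  rewrite P'S -mulNr /d -dE.
  by apply: (hypersphere_section FC) => //; rewrite dE.
exists P, P'; split.
- split; rewrite PD P'D; first exact: frame_dir_complement F ux wx u20 w20.
  exact: frame_dir_complement FC wx ux w20 u20.
- have [dlt|dgt|deq] := ltgtP d 0; last by rewrite deq eqxx in d0.
    right; split; first exact: indefinite_planeP F u20 (esym dE) dlt PD.
    exact: indefinite_planeP FC w20 erefl dlt P'D.
  left; split; first exact: definite_planeP F u20 (esym dE) dgt PD.
  exact: definite_planeP FC w20 erefl dgt P'D.
(* The sign of e / d decides between the upper and the lower signs. *)
exists p, (Num.sqrt `|e / d|); rewrite sqr_sqrtr // normr_eq0; split.
- exact: plane_set_meet F u20 w20 x13 Pp P'p PD P'D.
- by rewrite mulf_neq0 ?invr_eq0.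
rewrite SE S'E PS; have [ed|ed] := leP 0 (e / d).
  by left; rewrite ger0_norm.
by right; rewrite ltr0_norm ?opprK.
Qed.

Lemma frame_parabolic (R : realType) (e : R) u1 u2 u3 w1 w2 w3 :
  frame e u1 u2 u3 w1 w2 w3 ->
  form33 u2 (infty33 R) = 0 -> form33 w2 (infty33 R) = 0 ->
  form33 u1 (infty33 R) ^+ 2 = form33 u3 (infty33 R) ^+ 2 ->
  form33 u1 (infty33 R) != 0 -> form33 w1 (infty33 R) != 0 ->
  exists P P' : plane R,
    [/\ complementary P P', degenerate_plane P, degenerate_plane P' &
        parabolic_sections (section3 w1 w2 w3) (section3 u1 u2 u3) P P'].
Proof.
move=> F u20 w20 x13 x10 y10; have FC := frameC F.
have e0 := frame_sign_neq0 F.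
have y13 : form33 w1 (infty33 R) ^+ 2 = form33 w3 (infty33 R) ^+ 2.
  by have := frame_infty F u20 w20; rewrite x13 subrr; lra.
have x30 : form33 u3 (infty33 R) != 0 by rewrite -sqrf_eq0 -x13 sqrf_eq0.
have y30 : form33 w3 (infty33 R) != 0 by rewrite -sqrf_eq0 -y13 sqrf_eq0.
have ux : meets_infty u1 u3 by case=> h1 _; rewrite h1 eqxx in x10.
have wx : meets_infty w1 w3 by case=> h1 _; rewrite h1 eqxx in y10.
(* The coefficients make (t, n) = 1, and t is null because v1 and v3 have opposite norms and
   products with n of equal square. With v1, v3 in U this gives p, in U^perp it gives q. *)
have lift_pt f v1 v3 : form33 v1 v1 = f -> form33 v3 v3 = - f ->
    form33 v1 v3 = 0 -> form33 v1 (infty33 R) != 0 ->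
    form33 v3 (infty33 R) != 0 ->
    form33 v1 (infty33 R) ^+ 2 = form33 v3 (infty33 R) ^+ 2 ->
    let t := (2 * form33 v1 (infty33 R))^-1 *: v1
             + (2 * form33 v3 (infty33 R))^-1 *: v3 in
    lift33 (mid33 t) = t.
  move=> v11 v33 v13 z1 z3 z13 t; apply: lift33_mid; rewrite /t !form33E.
    rewrite v11 v33 (form33C v3 v1) v13.
    transitivity (f / 4 * ((form33 v1 (infty33 R) ^+ 2)^-1
      - (form33 v3 (infty33 R) ^+ 2)^-1)); first by field; rewrite z1 z3.
    by rewrite z13 subrr mulr0.
  by field; rewrite z1 z3.
have pE := lift_pt _ _ _ (frame11 F) (frame33 F) (frame13 F) x10 x30 x13.
have qE := lift_pt _ _ _ (frame11 FC) (frame33 FC) (frame13 FC) y10 y30 y13.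
rewrite /= in pE qE; set p := mid33 _ in pE; set q := mid33 _ in qE.
have [P [_ PD PS]] := @frame_plane R e u1 u2 u3 w1 w2 w3 p F ux wx u20 w20
  ltac:(by rewrite pE !form33E !(frameE F); ring)
  ltac:(by rewrite pE /asymptote !form33E !(frameE F); ring).
have [P' [_ P'D P'S]] := @frame_plane R _ w1 w2 w3 u1 u2 u3 q FC wx ux w20 u20
  ltac:(by rewrite qE !form33E !(frameE F); ring)
  ltac:(by rewrite qE /asymptote !form33E !(frameE F); ring).
exists P, P'; split.
- split; rewrite PD P'D; first exact: frame_dir_complement F ux wx u20 w20.
  exact: frame_dir_complement FC wx ux w20 u20.
- exact: degenerate_planeP F u20 x13 PD.
- exact: degenerate_planeP FC w20 y13 P'D.
split.
  (* At a common point the two equations of [asymptote] annihilate both differences in [frame_lift],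
     leaving e = 0. *)
  apply/seteqP; split=> // y [].
  rewrite PS P'S /asymptote /= !form33E => -[_ hw] [_ hu].
  have := frame_lift y F u20 w20.
  have balanced a b v1 v3 : v1 != 0 -> v1 ^+ 2 = v3 ^+ 2 ->
      v3 * a + - (v1 * b) = 0 -> a * v1 - b * v3 = 0 :> R.
    move=> v10 v13 h; apply: (mulfI v10); rewrite mulr0.
    transitivity (v3 * (v3 * a + - (v1 * b)) + (v1 ^+ 2 - v3 ^+ 2) * a).
      by ring.
    by rewrite h v13 subrr mulr0 mul0r addr0.
  rewrite (balanced _ _ _ _ x10 x13 hu) (balanced _ _ _ _ y10 y13 hw) add0r.
  by move/esym/eqP; rewrite (negPf e0).
have pq : form33 (lift33 p) (lift33 q) = 0.
  by rewrite pE qE !form33E !(frameE F); ring.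
exists p, q; split.
- rewrite PS /= pE /asymptote !form33E !(frameE F); split; ring.
- rewrite P'S /= qE /asymptote !form33E !(frameE F); split; ring.
- by rewrite /null_separated; move: pq; rewrite form33_lift; lra.
- by rewrite PS; exact: null_cone_section y10 y13 qE.
- by rewrite P'S; exact: null_cone_section x10 x13 pE.
Qed.

Theorem theorem1p1 (R : realType) (S S' : set 'cV[R]_4)
    (hS : conjugate_conics S S') :
  ((is_line S /\ S' = set0) \/ (is_line S' /\ S = set0)) \/
  (exists P P' : plane R,
     [/\ complementary P P',
         S `<=` plane_set P,
         S' `<=` plane_set P' &
         [\/ [/\ definite_plane P, definite_plane P' &
                 concentric_sections S S' P P'],
             [/\ indefinite_plane P, indefinite_plane P' &
                 concentric_sections S S' P P'] |
             [/\ degenerate_plane P, degenerate_plane P' &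
                 parabolic_sections S S' P P']]]).
Proof.
have [e [u1 [u2 [u3 [w1 [w2 [w3 [F -> ->]]]]]]]] := conjugate_conics_frame hS.
(* Rotate both triples so that their second vectors become orthogonal to n; the sections stay the
   same. *)
have [v1 [v2 [{}F v20 <-]]] := frame_rotate F.
have [z1 [z2 [FC z20 <-]]] := frame_rotate (frameC F).
have {}F := frameC FC.
have x13 := frame_infty FC z20 v20.
(* Equality is the case k = 0. Then a vanishing first product forces the third to vanish, so n1 = 0
   or n2 = 0 gives a line and the empty set, and otherwise the conics are parabolae. *)
have [d0|d0] := eqVneq (form33 v1 (infty33 R) ^+ 2) (form33 u3 (infty33 R) ^+ 2).
  have y13 : form33 z1 (infty33 R) ^+ 2 = form33 w3 (infty33 R) ^+ 2.
    by move: x13; rewrite d0 subrr; lra.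
  have [x10|x10] := eqVneq (form33 v1 (infty33 R)) 0.
    have x30 : form33 u3 (infty33 R) = 0.
      by apply/eqP; rewrite -sqrf_eq0 -d0 x10 expr0n.
    by left; right; exact: frame_line F v20 z20 x10 x30.
  have [y10|y10] := eqVneq (form33 z1 (infty33 R)) 0.
    have y30 : form33 w3 (infty33 R) = 0.
      by apply/eqP; rewrite -sqrf_eq0 -y13 y10 expr0n.
    by left; left; exact: frame_line FC z20 v20 y10 y30.
  have [P [P' [PP' Pd P'd PS]]] := frame_parabolic F v20 z20 d0 x10 y10.
  right; exists P, P'; split=> //; last by apply: Or33.
    by case: PS => _ [p [q [_ _ _ -> _]]] y [].
  by case: PS => _ [p [q [_ _ _ _ ->]]] y [].
have [P [P' [PP' Pd PS]]] := frame_central F v20 z20 d0.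
right; exists P, P'; split=> //; last first.
  by case: Pd => [[]|[]] ? ?; [apply: Or31|apply: Or32].
  by case: PS => p [r [_ _ [[_ ->]|[_ ->]]]] y [].
by case: PS => p [r [_ _ [[-> _]|[-> _]]]] y [].
Qed.
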